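(* Let $\varphi:\mathbb{R}^{n-1}\to\mathbb{R}$ be $L$-Lipschitz and let $\Omega_\varphi:=\{(y',y_n):y_n>\varphi(y')\}$. Fix $x=(x',x_n)\in\Omega_\varphi$ and set $r:=x_n-\varphi(x')>0$. Then $$\frac{r}{1+L}\le d_{\Omega_\varphi}(x)\le r,$$ and, with $\eta:=\alpha:=\frac{1}{4(1+L)}$ and $$E_x:=\bigl\{(\xi',\varphi(\xi'))\in\partial\Omega_\varphi:\ |\xi'-x'|\le\eta r\bigr\},$$ one has $E_x\subset\partial^{\mathrm{str}}_{x,\alpha}\Omega_\varphi$ and $\mathcal H^{n-1}_\infty(E_x)\ge c\,d_{\Omega_\varphi}(x)^{n-1}$ with a constant $c>0$ depending only on $n$ and $L$. Thus Lipschitz graph domains satisfy the content condition (S) defined in the context locally with $\lambda=n-1$.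
   Context: Points of $\mathbb{R}^n$ are written $(y',y_n)\in\mathbb{R}^{n-1}\times\mathbb{R}$. Let $d_\Omega(y):=\operatorname{dist}(y,\partial\Omega)$ and let $B(y,r)$ be the open ball. For $x\ne\xi$, $[x,\xi):=\{(1-t)x+t\xi:0\le t<1\}$. For a domain $\Omega$, $x\in\Omega$ and $\alpha\in(0,1]$, $$\partial^{\mathrm{str}}_{x,\alpha}\Omega:=\bigl\{\xi\in\partial\Omega:\ [x,\xi)\subset\Omega\ \text{ and }\ d_\Omega((1-t)x+t\xi)\ge\alpha\min\{t,1-t\}|x-\xi|\ \text{ for every }t\in(0,1)\bigr\}.$$ The $\lambda$-Hausdorff content of $E\subset\mathbb{R}^n$ is $\mathcal H^\lambda_\infty(E):=\inf\{\sum_{i=1}^\infty r_i^\lambda: E\subset\bigcup_{i=1}^\infty B(x_i,r_i)\}$. The content condition (S) for a domain $\Omega$ is $$(\mathrm{S})\qquad \mathcal H^\lambda_\infty\bigl(\partial^{\mathrm{str}}_{x,\alpha}\Omega\cap B(x,C_0d_\Omega(x))\bigr)\ge c_0\,d_\Omega(x)^\lambda\qquad\text{for every }x\in\Omega,$$ with constants $c_0>0$, $C_0\ge2$, $\alpha\in(0,1]$ and an exponent $0\le\lambda\le n$. *)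

(* Defs.v *)
(* MathComp-Analysis *)
From HB Require Import structures.
From mathcomp Require Import all_boot all_order all_algebra.
From mathcomp Require Import all_classical all_reals all_analysis.

Set Implicit Arguments.
Unset Strict Implicit.
Unset Printing Implicit Defensive.

Import Order.TTheory GRing.Theory Num.Theory.
Import numFieldNormedType.Exports.

Local Open Scope classical_set_scope.
Local Open Scope ring_scope.

(* Points of R^n are row vectors 'rV[R]_n.  The library norm on 'rV[R]_n is the
   sup norm, so the Euclidean norm is introduced here; both induce the library
   topology of 'rV[R]_n, which is the one used for open, closure, interior and
   connected below. *)
Definition enorm (R : realType) (n : nat) (v : 'rV[R]_n) : R :=
  Num.sqrt (\sum_(i < n) v 0 i ^+ 2).

Definition eball (R : realType) (n : nat) (x : 'rV[R]_n) (r : R) :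
    set 'rV[R]_n :=
  [set y | enorm (y - x) < r].

Definition boundary (R : realType) (n : nat) (A : set 'rV[R]_n) :
    set 'rV[R]_n :=
  closure A `\` interior A.

Definition domain (R : realType) (n : nat) (Omega : set 'rV[R]_n) : Prop :=
  [/\ open Omega, connected Omega & Omega !=set0].

(* dist(y, boundary of Omega); meaningful when the boundary is nonempty
   (inf set0 = 0 in the library). *)
Definition bdist (R : realType) (n : nat) (Omega : set 'rV[R]_n)
    (y : 'rV[R]_n) : R :=
  inf [set enorm (y - z) | z in boundary Omega].

Definition segpt (R : realType) (n : nat) (x xi : 'rV[R]_n) (t : R) :
    'rV[R]_n :=
  (1 - t) *: x + t *: xi.

Definition strboundary (R : realType) (n : nat) (Omega : set 'rV[R]_n)
    (x : 'rV[R]_n) (alpha : R) : set 'rV[R]_n :=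
  [set xi | [/\ boundary Omega xi,
      (forall t : R, 0 <= t < 1 -> Omega (segpt x xi t)) &
      (forall t : R, 0 < t < 1 ->
         alpha * Num.min t (1 - t) * enorm (x - xi)
           <= bdist Omega (segpt x xi t))]].

(* Balls of radius 0 are empty and contribute nothing to the sum, so that
   finite covers are allowed.  The restriction to positive radii matters only
   for lambda = 0, since the library has 0 `^ 0 = 1. *)
Definition hcontent (R : realType) (n : nat) (lambda : R) (E : set 'rV[R]_n) :
    \bar R :=
  ereal_inf [set s : \bar R | exists (c : nat -> 'rV[R]_n) (r : nat -> R),
    [/\ (forall i, 0 <= r i),
        E `<=` \bigcup_i eball (c i) (r i) &
        s = (\sum_(0 <= i <oo | (0 < r i)%R) ((r i) `^ lambda)%:E)%E]].

Definition content_condition (R : realType) (n : nat) (Omega : set 'rV[R]_n)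
    (lambda c0 C0 alpha : R) : Prop :=
  [/\ domain Omega,
      [/\ 0 < c0, 2 <= C0, 0 < alpha <= 1 & 0 <= lambda <= n%:R] &
      forall x : 'rV[R]_n, Omega x ->
        ((c0 * bdist Omega x `^ lambda)%:E
          <= hcontent lambda
               (strboundary Omega x alpha `&` eball x (C0 * bdist Omega x)))%E].

(* A point (y', y_n) of R^(m + 1) is row_mx y' y_n%:M, with y' : 'rV[R]_m. *)
Definition mkpt (R : realType) (m : nat) (y' : 'rV[R]_m) (t : R) :
    'rV[R]_(m + 1) :=
  row_mx y' t%:M.

Definition base (R : realType) (m : nat) (y : 'rV[R]_(m + 1)) : 'rV[R]_m :=
  lsubmx y.

Definition height (R : realType) (m : nat) (y : 'rV[R]_(m + 1)) : R :=
  rsubmx y 0 0.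

Definition elipschitz (R : realType) (m : nat) (L : R) (phi : 'rV[R]_m -> R) :
    Prop :=
  forall u v : 'rV[R]_m, `|phi u - phi v| <= L * enorm (u - v).

Definition graph_domain (R : realType) (m : nat) (phi : 'rV[R]_m -> R) :
    set 'rV[R]_(m + 1) :=
  [set y | phi (base y) < height y].

Definition graph_piece (R : realType) (m : nat) (phi : 'rV[R]_m -> R)
    (x : 'rV[R]_(m + 1)) (rho : R) : set 'rV[R]_(m + 1) :=
  [set xi | boundary (graph_domain phi) xi /\
     exists2 xi' : 'rV[R]_m,
       xi = mkpt xi' (phi xi') & enorm (xi' - base x) <= rho].

(* Main.v *)
Require Import Defs.
From HB Require Import structures.
From mathcomp Require Import all_boot all_order all_algebra.
From mathcomp Require Import all_classical all_reals all_analysis.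
From mathcomp Require Import finmap ring lra.

(** Write F y = y_n - phi(y') for the vertical gap between y = (y', y_n) and
    the graph.
    Everything rests on the fact that F is (1 + L)-Lipschitz for the Euclidean
    norm ([gap_lipschitz]).  Hence a point with F y <> 0 has a ball of radius
    |F y| / (1 + L) on which F keeps its sign, so that the boundary of the
    domain is exactly the zero set of F ([boundary_graph_domain]), and the
    distance of y to it lies between F y / (1 + L) and |F y| ([bdist_ge],
    [bdist_le]).

    For the starlike part, let xi be a point of the graph whose base is within
    r / (4 (1 + L)) of that of x, where r = F x.  Along the segment from x to
    xi the function phi oscillates by at most r / 4, so the gap at parameter t
    is at least (1 - t) r / 2 ([gap_segpt_ge]), whereas |x - xi| <= 5 r / 4
    ([enorm_graph_piece]).  With the factor 1 / (4 (1 + L)) in front, the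
    required lower bound (5 / 16) min(t, 1 - t) r / (1 + L) is smaller than the
    available (1 / 2) (1 - t) r / (1 + L) ([graph_piece_strboundary]).

    For the content, project a cover of the piece of graph to R^m.  The
    projections cover a cube of side s comparable to r, and balls covering a
    cube satisfy sum r_i^m >= (s / 3)^m ([cube_cover_sum]).  The latter is
    volume comparison done by counting: by compactness finitely many balls
    suffice, and on a grid of N^m points with mesh at most every radius the
    ball of radius r_i catches at most (3 r_i N / s)^m points
    ([finite_cube_cover_sum]).  As d <= r, this gives the content bound with
    d^m in place of r^m.

    The content condition combines these facts: the piece of graph lies within
    5 r / 4 <= 5 (1 + L) d / 4 of x, hence in the ball of radius
    2 (1 + L) d. *)

Set Implicit Arguments.
Unset Strict Implicit.
Unset Printing Implicit Defensive.

Import Order.TTheory GRing.Theory Num.Theory.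
Import numFieldNormedType.Exports.

Local Open Scope classical_set_scope.
Local Open Scope ring_scope.

(** * The Euclidean norm and the topology of row vectors *)

Lemma enorm_ge0 (R : realType) (n : nat) (v : 'rV[R]_n) : 0 <= enorm v.
Proof. exact: sqrtr_ge0. Qed.

Lemma enormN (R : realType) (n : nat) (v : 'rV[R]_n) : enorm (- v) = enorm v.
Proof.
by rewrite /enorm; congr Num.sqrt; apply: eq_bigr => i _; rewrite mxE sqrrN.
Qed.

Lemma enormZ (R : realType) (n : nat) (a : R) (v : 'rV[R]_n) :
  enorm (a *: v) = `|a| * enorm v.
Proof.
rewrite /enorm -sqrtr_sqr -sqrtrM ?sqr_ge0// mulr_sumr; congr Num.sqrt.
by apply: eq_bigr => i _; rewrite mxE exprMn.
Qed.

Lemma enorm_coord (R : realType) (n : nat) (v : 'rV[R]_n) (i : 'I_n) :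
  `|v 0 i| <= enorm v.
Proof.
rewrite -sqrtr_sqr ler_wsqrtr// (bigD1 i)//= lerDl.
by apply: sumr_ge0 => j _; exact: sqr_ge0.
Qed.

Lemma sum_sqr_le_sqr_sum (R : realType) (n : nat) (f : 'I_n -> R) :
  (forall i, 0 <= f i) -> \sum_i f i ^+ 2 <= (\sum_i f i) ^+ 2.
Proof.
elim: n f => [|n IH] f f0; first by rewrite !big_ord0 expr2 mulr0.
rewrite !big_ord_recl sqrrD -addrA lerD2l.
rewrite (le_trans (IH _ _))// lerDr mulrn_wge0// mulr_ge0//.
by apply: sumr_ge0.
Qed.

Lemma enorm_le_sum (R : realType) (n : nat) (v : 'rV[R]_n) :
  enorm v <= \sum_i `|v 0 i|.
Proof.
have s0 : 0 <= \sum_i `|v 0 i| by apply: sumr_ge0.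
rewrite -[leRHS]ger0_norm// -sqrtr_sqr ler_wsqrtr//.
rewrite (le_trans _ (sum_sqr_le_sqr_sum _))//.
by apply: ler_sum => i _; rewrite real_normK ?num_real.
Qed.

Lemma enorm_le_coord (R : realType) (n : nat) (v : 'rV[R]_n) (s : R) :
  (forall i, `|v 0 i| <= s) -> enorm v <= n%:R * s.
Proof.
move=> vs; rewrite (le_trans (enorm_le_sum v))//.
rewrite (le_trans (ler_sum _ (fun i _ => vs i)))//.
by rewrite sumr_const card_ord mulr_natl.
Qed.

(** The library topology is that of the sup norm; the two norms are compared
    by [enorm_coord] and [enorm_le_coord], so Euclidean balls form a basis of
    neighbourhoods as well. *)
Lemma nbhs_eballP (R : realType) (n : nat) (x : 'rV[R]_n) (A : set 'rV[R]_n) :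
  nbhs x A <-> exists2 e, 0 < e & eball x e `<=` A.
Proof.
split=> [/nbhs_ballP[e /= e0 eA]|[e e0 eA]].
  exists e => // y xy; apply: eA; split => // i j.
  rewrite !ord1; rewrite /ball /= distrC.
  by rewrite (le_lt_trans _ xy)// (le_trans _ (enorm_coord _ j))// !mxE.
apply/nbhs_ballP; exists (e / n.+1%:R) => /=; first by rewrite divr_gt0.
move=> y [_ xy]; apply: eA; rewrite /eball /=.
have /enorm_le_coord h : forall i, `|(y - x) 0 i| <= e / n.+1%:R.
  by move=> i; rewrite !mxE distrC ltW//; exact: xy.
rewrite (le_lt_trans h)// mulrCA gtr_pMr// ltr_pdivrMr// mul1r.
by rewrite ltr_nat.
Qed.

Lemma elipschitz_continuous (R : realType) (n : nat) (K : R)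
    (g : R -> 'rV[R]_n) :
  (forall s t, enorm (g s - g t) <= K * `|s - t|) -> continuous g.
Proof.
move=> gK t A /nbhs_eballP[e e0 eA].
have K1 : 0 < `|K| + 1 by rewrite ltr_wpDl.
apply/nbhs_ballP; exists (e / (`|K| + 1)) => /=; first by rewrite divr_gt0.
move=> s /= ts; apply: eA; rewrite /eball/=.
rewrite (le_lt_trans (gK s t))//.
move: ts; rewrite /ball/= ltr_pdivlMr// distrC => ts.
rewrite (le_lt_trans _ ts)// mulrC ler_wpM2l//.
by rewrite (le_trans (ler_norm K))// lerDl.
Qed.

(** * Coordinates of a point over its base *)

Lemma base_mkpt (R : realType) (m : nat) (v : 'rV[R]_m) (t : R) :
  base (mkpt v t) = v.
Proof. exact: row_mxKl. Qed.

Lemma height_mkpt (R : realType) (m : nat) (v : 'rV[R]_m) (t : R) :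
  height (mkpt v t) = t.
Proof. by rewrite /height row_mxKr mxE eqxx mulr1n. Qed.

Lemma mkpt_base_height (R : realType) (m : nat) (y : 'rV[R]_(m + 1)) :
  mkpt (base y) (height y) = y.
Proof.
by rewrite /mkpt /base /height -mx11_scalar hsubmxK.
Qed.

Lemma baseB (R : realType) (m : nat) (y z : 'rV[R]_(m + 1)) :
  base (y - z) = base y - base z.
Proof. by rewrite /base linearB. Qed.

Lemma heightB (R : realType) (m : nat) (y z : 'rV[R]_(m + 1)) :
  height (y - z) = height y - height z.
Proof. by rewrite /height linearB !mxE. Qed.

Lemma base_segpt (R : realType) (m : nat) (y z : 'rV[R]_(m + 1)) (t : R) :
  base (segpt y z t) = segpt (base y) (base z) t.
Proof. by rewrite /base /segpt linearD !linearZ. Qed.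

Lemma height_segpt (R : realType) (m : nat) (y z : 'rV[R]_(m + 1)) (t : R) :
  height (segpt y z t) = (1 - t) * height y + t * height z.
Proof. by rewrite /height /segpt linearD !linearZ !mxE. Qed.

Lemma segptB (R : realType) (n : nat) (u v : 'rV[R]_n) (s t : R) :
  segpt u v s - segpt u v t = (s - t) *: (v - u).
Proof. by apply/rowP => i; rewrite !mxE; ring. Qed.

Lemma segpt0 (R : realType) (n : nat) (u v : 'rV[R]_n) : segpt u v 0 = u.
Proof. by rewrite /segpt subr0 scale1r scale0r addr0. Qed.

Lemma segpt1 (R : realType) (n : nat) (u v : 'rV[R]_n) : segpt u v 1 = v.
Proof. by rewrite /segpt subrr scale0r scale1r add0r. Qed.

Lemma enorm_sqrD (R : realType) (m : nat) (y : 'rV[R]_(m + 1)) :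
  enorm y = Num.sqrt (enorm (base y) ^+ 2 + height y ^+ 2).
Proof.
rewrite {1}/enorm big_split_ord/= big_ord1 sqr_sqrtr; last first.
  by apply: sumr_ge0 => i _; exact: sqr_ge0.
congr (Num.sqrt (_ + _)); last by rewrite /height mxE.
by apply: eq_bigr => i _; rewrite mxE.
Qed.

Lemma enorm_base_le (R : realType) (m : nat) (y : 'rV[R]_(m + 1)) :
  enorm (base y) <= enorm y.
Proof.
rewrite (enorm_sqrD y) -[leLHS]ger0_norm ?enorm_ge0// -sqrtr_sqr ler_wsqrtr//.
by rewrite lerDl sqr_ge0.
Qed.

Lemma height_le_enorm (R : realType) (m : nat) (y : 'rV[R]_(m + 1)) :
  `|height y| <= enorm y.
Proof. by rewrite (enorm_sqrD y) -sqrtr_sqr ler_wsqrtr// lerDr sqr_ge0. Qed.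

Lemma enorm_le_base_height (R : realType) (m : nat) (y : 'rV[R]_(m + 1)) :
  enorm y <= enorm (base y) + `|height y|.
Proof.
have b0 := enorm_ge0 (base y); have h0 := normr_ge0 (height y).
rewrite enorm_sqrD -[leRHS]ger0_norm ?addr_ge0// -sqrtr_sqr ler_wsqrtr//.
rewrite -[height y ^+ 2]real_normK ?num_real// sqrrD -addrA [leRHS]addrCA.
by rewrite addrC lerDl mulrn_wge0// mulr_ge0.
Qed.

(** * Covering a cube *)

(** At most 2 rho + 1 integers lie in an interval of length 2 rho; the
    assumption on rho absorbs the extra 1, which keeps the bound homogeneous. *)
Lemma card_near_le (R : realType) (N : nat) (c rho : R) : 1 <= rho ->
  (#|[pred k : 'I_N | `|k%:R - c| < rho]|)%:R <= 3 * rho.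
Proof.
move=> rho1; set A := [pred k : 'I_N | _].
have [/card0_eq A0|] := posnP #|A|; first by rewrite (eq_card A0) card0; lra.
case/card_gt0P => k1 Ak1.
(* all elements of A lie within 2 * rho above the least one *)
case: (@arg_minnP _ k1 (fun k => k \in A) (@nat_of_ord N) Ak1) => k0 Ak0 kmin.
pose M := (Num.truncn (2 * rho)).+1.
have kM (k : 'I_N) : k \in A -> (k - k0 < M)%N.
  move=> Ak; rewrite -(ltr_nat R) natrB; last exact: kmin.
  have h : k%:R - k0%:R < 2 * rho :> R.
    move: Ak Ak0; rewrite !inE !ltr_distl => /andP[_ ?] /andP[? _]; lra.
  rewrite (lt_le_trans h)// /M ltW//; exact: truncnS_gt.
have : (#|A| <= M)%N.
  rewrite -[leqRHS](card_ord M) -(@card_in_image _ _ (fun k : 'I_N =>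
    inord (k - k0) : 'I_M)); first exact: max_card.
  move=> k k' /= Ak Ak' /(congr1 (@nat_of_ord M)).
  rewrite !inordK ?kM// => kk'; apply/val_inj => /=.
  by rewrite -(subnK (kmin _ Ak)) -(subnK (kmin _ Ak')) kk'.
rewrite -(ler_nat R) => /le_trans; apply.
have /truncn_itv/andP[+ _] : 0 <= 2 * rho by lra.
by rewrite /M -natr1; lra.
Qed.

(** A grid of N^m points in the cube is counted ball by ball: once the mesh
    s / N is at most every radius, a ball of radius r contains at most
    (3 r N / s)^m of them, and the factor N^m cancels. *)
Lemma finite_cube_cover_sum (R : realType) (m : nat) (a : 'rV[R]_m) (s : R)
    (c : nat -> 'rV[R]_m) (r : nat -> R) (M : nat) :
  0 < s ->
  [set v : 'rV[R]_m | forall j, a 0 j <= v 0 j <= a 0 j + s] `<=`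
    \bigcup_(i in [set i | (i < M)%N]) ball (c i) (r i) ->
  (s / 3) ^+ m <= \sum_(i < M | 0 < r i) r i ^+ m.
Proof.
move=> s0 cov.
(* N is at least s / r i for every positive radius at once: a sum bounds each of
   its terms *)
have [N N0 Ns] : exists2 N, (0 < N)%N &
    forall i : 'I_M, 0 < r i -> s <= r i * N%:R.
  exists (\sum_(i < M) (Num.truncn (s / r i)).+1).+1 => // i ri0.
  rewrite mulrC -ler_pdivrMr//.
  have /ltW/le_trans := truncnS_gt (s / r i); apply.
  by rewrite ler_nat (bigD1 i)//=; exact: leqW (leq_addr _ _).
have NR0 : 0 < N%:R :> R by rewrite ltr0n.
pose pt (f : {ffun 'I_m -> 'I_N}) : 'rV[R]_m :=
  \row_j (a 0 j + s / N%:R * (f j)%:R).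
(* the ball condition on one coordinate, rescaled so that the mesh becomes 1 *)
pose near (i : 'I_M) (j : 'I_m) : pred 'I_N :=
  [pred k : 'I_N | `|k%:R - (c i 0 j - a 0 j) / (s / N%:R)| < r i / (s / N%:R)].
have ptcov f : exists2 i : 'I_M, 0 < r i & f \in family (near i).
  have [|i /= iM [ri0 rif]] := cov (pt f).
    move=> j; rewrite mxE lerDl lerD2l mulr_ge0 ?divr_ge0 ?(ltW s0)//=.
    by rewrite mulrAC ler_pdivrMr// ler_wpM2l ?(ltW s0)// ler_nat ltnW.
  exists (Ordinal iM) => //; apply/familyP => j; rewrite inE /=.
  have := rif 0 j; rewrite /ball/= mxE distrC => h.
  have sN : 0 < s / N%:R by rewrite divr_gt0.
  rewrite ltr_pdivlMr// -{2}[s / _]gtr0_norm// -normrM mulrBl divfK ?gt_eqF//.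
  by rewrite mulrC opprB addrCA addrA.
have famle (i : 'I_M) : 0 < r i ->
    (#|family (near i)|)%:R <= (3 / s * N%:R) ^+ m * r i ^+ m.
  move=> ri0; rewrite card_family foldrE big_map big_enum/=.
  rewrite natr_prod -exprMn -[X in _ <= _ ^+ X](card_ord m) -prodr_const.
  apply: ler_prod => j _; rewrite ler0n/=.
  rewrite (le_trans (card_near_le _ _ _))//.
    by rewrite invf_div mulrA ler_pdivlMr// mul1r Ns.
  by rewrite invf_div le_eqVlt; apply/predU1P; left; field; rewrite !gt_eqF.
have : (N ^ m)%:R <= \sum_(i < M | 0 < r i) (#|family (near i)|)%:R :> R.
  rewrite -natr_sum ler_nat.
  have <- : #|{ffun 'I_m -> 'I_N}| = (N ^ m)%N by rewrite card_ffun !card_ord.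
  rewrite -sum1_card.
  under [leqRHS]eq_bigr do rewrite -sum1_card big_mkcond.
  rewrite exchange_big/=; apply: leq_sum => f _.
  have [i ri0 fi] := ptcov f.
  by rewrite (bigD1 i)//= fi.
move=> /le_trans/(_ (ler_sum _ famle)).
rewrite -mulr_sumr natrX exprMn mulrAC ler_pMl ?exprn_gt0//.
rewrite -[3 / s]invf_div exprVn mulrC ler_pdivlMr ?exprn_gt0 ?divr_gt0//.
by rewrite mul1r.
Qed.

Lemma open_row_ball (R : realType) (m : nat) (c : 'rV[R]_m) (r : R) :
  open (ball c r).
Proof.
rewrite openE => v [r0 cv].
exists (fun i j => ball (c i j) r) => [i j|w cw]; last by split.
exact: open_nbhs_nbhs (conj (ball_open _ _) (cv i j)).
Qed.

Lemma cube_cover_sum (R : realType) (m : nat) (a : 'rV[R]_m) (s : R)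
    (c : nat -> 'rV[R]_m) (r : nat -> R) :
  0 < s ->
  [set v : 'rV[R]_m | forall j, a 0 j <= v 0 j <= a 0 j + s] `<=`
    \bigcup_i ball (c i) (r i) ->
  exists M, (s / 3) ^+ m <= \sum_(i < M | 0 < r i) r i ^+ m.
Proof.
move=> s0 cov.
have : compact
    [set v : 'rV[R]_m | forall j, `[a 0 j, a 0 j + s]%classic (v 0 j)].
  apply: (@rV_compact _ _ (fun j => `[a 0 j, a 0 j + s]%classic)) => j.
  exact: segment_compact.
(* the maximum of a finite set of indices turns it into an initial segment *)
rewrite compact_cover => /(_ nat setT (fun i => ball (c i) (r i))) [].
- move=> i _; exact: open_row_ball.
- move=> v Qv; have [|i _ vi] := cov v; last by exists i.
  by move=> j; have := Qv j; rewrite /= in_itv.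
move=> D _ covD.
exists (\max_(i <- D) i).+1; apply: finite_cube_cover_sum s0 _ => v Qv.
have [|i /= iD vi] := covD v; first by move=> j; rewrite /= in_itv; exact: Qv.
exists i; last exact: vi.
by rewrite /= ltnS (@leq_bigmax_seq _ _ xpredT id).
Qed.

(** Projection to the base maps Euclidean balls into sup-norm balls of the same
    radius, so a cover of E projects to a cover of the cube.  A ball that
    contains a point has positive radius, also in dimension m = 0, where the
    coordinates impose no condition. *)
Lemma hcontent_ge_base_cube (R : realType) (m : nat) (E : set 'rV[R]_(m + 1))
    (a : 'rV[R]_m) (s : R) :
  0 < s ->
  [set v : 'rV[R]_m | forall j, a 0 j <= v 0 j <= a 0 j + s] `<=`
    (@base R m) @` E ->
  (((s / 3) ^+ m)%:E <= hcontent m%:R E)%E.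
Proof.
move=> s0 aE; apply: le_ereal_inf_tmp => _ [c [r [r0 Ec ->]]].
have [|M sM] := @cube_cover_sum R m a s (fun i => base (c i)) r s0.
  move=> v /aE[y Ey <-]; have [i _ yi] := Ec y Ey; exists i => //.
  split=> [|j k]; first by rewrite (le_lt_trans (enorm_ge0 _) yi).
  rewrite ord1 /ball/= distrC (le_lt_trans _ yi)//.
  rewrite (le_trans _ (enorm_base_le _))// baseB.
  by rewrite (le_trans _ (enorm_coord _ k))// !mxE.
apply: (@le_trans _ _ (\sum_(0 <= i < M | (0 < r i)%R) (r i `^ m%:R)%:E)%E).
  rewrite sumEFin lee_fin big_mkord (le_trans sM)//.
  by apply: ler_sum => i _; rewrite powR_mulrn.
by apply: nneseries_lim_ge => i _ _; rewrite lee_fin powR_ge0.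
Qed.

Lemma le_hcontent (R : realType) (n : nat) (lambda : R) (E F : set 'rV[R]_n) :
  E `<=` F -> (hcontent lambda E <= hcontent lambda F)%E.
Proof.
move=> EF; apply: ereal_inf_le_tmp => _ [c [r [r0 Fc ->]]].
by exists c, r; split => //; exact: subset_trans Fc.
Qed.

(** * The boundary of a Lipschitz graph domain *)

(** A defining function of the domain, positive exactly there; being Lipschitz,
    it controls the distance to the boundary. *)
Definition gap (R : realType) (m : nat) (phi : 'rV[R]_m -> R)
  (y : 'rV[R]_(m + 1)) : R := height y - phi (base y).

Lemma graph_domainE (R : realType) (m : nat) (phi : 'rV[R]_m -> R)
    (y : 'rV[R]_(m + 1)) : graph_domain phi y = (0 < gap phi y) :> Prop.
Proof. by rewrite /gap subr_gt0. Qed.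

Lemma gap_mkpt (R : realType) (m : nat) (phi : 'rV[R]_m -> R) (v : 'rV[R]_m)
    (h : R) : gap phi (mkpt v (phi v + h)) = h.
Proof. by rewrite /gap base_mkpt height_mkpt addrAC subrr add0r. Qed.

Section lipschitz_graph.
Variables (R : realType) (m : nat) (L : R) (phi : 'rV[R]_m -> R).
Hypotheses (hL : 0 <= L) (phiL : elipschitz L phi).
Let Omega := graph_domain phi.
Let L1_gt0 : 0 < 1 + L. Proof. by rewrite ltr_wpDr. Qed.

Lemma gap_lipschitz (y z : 'rV[R]_(m + 1)) :
  `|gap phi y - gap phi z| <= (1 + L) * enorm (y - z).
Proof.
have -> : gap phi y - gap phi z =
    height (y - z) - (phi (base y) - phi (base z)).
  by rewrite heightB /gap; ring.
rewrite (le_trans (ler_normB _ _))// mulrDl mul1r lerD ?height_le_enorm//.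
rewrite (le_trans (phiL _ _))// -baseB ler_wpM2l//; exact: enorm_base_le.
Qed.

(** The Lipschitz bound forbids a change of sign.  At points
    of positive gap this yields that the domain is open, at points of negative
    gap that they are outside its closure. *)
Lemma eball_gap_gt0 (y z : 'rV[R]_(m + 1)) :
  eball y (`|gap phi y| / (1 + L)) z -> 0 < gap phi y * gap phi z.
Proof.
rewrite /eball/= ltr_pdivlMr// mulrC => yz.
have := le_lt_trans (gap_lipschitz z y) yz.
move: (gap phi y) (gap phi z) => u w.
rewrite ltr_distl; have [u0|u0] := leP 0 u => /andP[].
  by rewrite ger0_norm// => ? ?; rewrite mulr_gt0//; lra.
by rewrite ltr0_norm// => ? ?; rewrite nmulr_rgt0//; lra.
Qed.

Lemma open_graph_domain : open Omega.
Proof.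
rewrite openE => y; rewrite /Omega graph_domainE => y0.
apply/nbhs_eballP; exists (`|gap phi y| / (1 + L)).
  by rewrite divr_gt0// normr_gt0 gt_eqF.
by move=> z /eball_gap_gt0; rewrite graph_domainE pmulr_rgt0.
Qed.

Lemma boundary_graph_domain (y : 'rV[R]_(m + 1)) :
  boundary Omega y <-> gap phi y = 0.
Proof.
split=> [[cy iy]|y0].
  have y0 : ~ 0 < gap phi y.
    move=> y0; apply: iy; rewrite ((interior_id _).1 open_graph_domain).
    by rewrite /Omega graph_domainE.
  apply/eqP; rewrite eq_le; apply/andP; split.
    by rewrite leNgt; apply/negP.
  rewrite leNgt; apply/negP => yn.
  have /cy[z [+ /eball_gap_gt0]] : nbhs y (eball y (`|gap phi y| / (1 + L))).
    apply/nbhs_eballP; exists (`|gap phi y| / (1 + L)) => //.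
    by rewrite divr_gt0// normr_gt0 lt_eqF.
  by rewrite /Omega graph_domainE => z0; rewrite nmulr_rgt0// ltNge ltW.
split=> [B /nbhs_eballP[e e0 eB]|/interior_subset]; last first.
  by rewrite /Omega graph_domainE y0 ltxx.
exists (mkpt (base y) (phi (base y) + e / 2)); split.
  by rewrite /Omega graph_domainE gap_mkpt divr_gt0.
apply: eB; rewrite /eball/=; apply: (le_lt_trans (enorm_le_base_height _)).
have -> : phi (base y) = height y.
  by apply/esym/eqP; rewrite -subr_eq0; apply/eqP.
rewrite baseB heightB base_mkpt height_mkpt subrr addrAC subrr add0r.
have -> : enorm (0 : 'rV[R]_m) = 0 by rewrite -(scale0r 0) enormZ normr0 mul0r.
by rewrite add0r gtr0_norm; lra.
Qed.

Lemma boundary_mkpt (v : 'rV[R]_m) : boundary Omega (mkpt v (phi v)).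
Proof. by apply/boundary_graph_domain; rewrite -[phi v]addr0 gap_mkpt. Qed.

Lemma bdist_ge (y : 'rV[R]_(m + 1)) : gap phi y / (1 + L) <= bdist Omega y.
Proof.
apply: lb_le_inf.
  exists (enorm (y - mkpt 0 (phi 0))), (mkpt 0 (phi 0)) => //.
  exact: boundary_mkpt.
move=> _ [z /boundary_graph_domain z0 <-]; rewrite ler_pdivrMr// mulrC.
by rewrite (le_trans _ (gap_lipschitz y z))// z0 subr0 ler_norm.
Qed.

(** The point of the graph on the vertical line through y is a competitor. *)
Lemma bdist_le (y : 'rV[R]_(m + 1)) : bdist Omega y <= `|gap phi y|.
Proof.
set z := mkpt (base y) (phi (base y)).
apply: (@le_trans _ _ (enorm (y - z))).
  apply: ge_inf; last by exists z => //; exact: boundary_mkpt.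
  by exists 0 => _ [w _ <-]; exact: enorm_ge0.
rewrite (le_trans (enorm_le_base_height _))// baseB heightB base_mkpt.
rewrite height_mkpt subrr -(scale0r 0) enormZ normr0 mul0r add0r//.
Qed.

(** The shear [(v, h) |-> (v, phi v + h)] straightens the domain to a half
    space; segments there become Lipschitz paths inside the domain. *)
Lemma connected_graph_domain : connected Omega.
Proof.
pose path (p q : 'rV[R]_(m + 1)) (t : R) : 'rV[R]_(m + 1) :=
  let b := segpt (base p) (base q) t in
  mkpt b (phi b + ((1 - t) * gap phi p + t * gap phi q)).
have path_cont p q : continuous (path p q).
  pose K := enorm (base q - base p).
  apply: (@elipschitz_continuous _ _ (K + (L * K + `|gap phi q - gap phi p|))).
  move=> s t; rewrite (le_trans (enorm_le_base_height _))//.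
  rewrite baseB heightB !base_mkpt !height_mkpt segptB enormZ.
  rewrite [leRHS]mulrDl [_ * enorm _]mulrC lerD2l [leRHS]mulrDl.
  set u := segpt _ _ s; set v := segpt _ _ t.
  have -> : phi u + ((1 - s) * gap phi p + s * gap phi q) -
     (phi v + ((1 - t) * gap phi p + t * gap phi q)) =
     (phi u - phi v) + (gap phi q - gap phi p) * (s - t) by ring.
  rewrite (le_trans (ler_normD _ _))// normrM lerD2r (le_trans (phiL _ _))//.
  by rewrite segptB enormZ -mulrA ler_wpM2l// mulrC.
have path_gap p q t :
    gap phi (path p q t) = (1 - t) * gap phi p + t * gap phi q.
  exact: gap_mkpt.
have path_end p q t v : segpt (base p) (base q) t = base v ->
    (1 - t) * gap phi p + t * gap phi q = gap phi v -> path p q t = v.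
  move=> bv gv; rewrite /path bv gv /gap addrC subrK; exact: mkpt_base_height.
have path0 p q : path p q 0 = p.
  by apply: path_end; rewrite ?segpt0// subr0 mul1r mul0r addr0.
have path1 p q : path p q 1 = q.
  by apply: path_end; rewrite ?segpt1// subrr mul1r mul0r add0r.
pose p : 'rV[R]_(m + 1) := mkpt 0 (phi 0 + 1).
have p1 : gap phi p = 1 by exact: gap_mkpt.
have -> : Omega = \bigcup_(q in Omega) (path p q @` `[0, 1]%classic).
  apply/seteqP; split=> [q Oq|y [q +] [t + <-]].
    by exists q => //; exists 1; rewrite ?path1//= in_itv/= lexx ler01.
  rewrite /Omega !graph_domainE path_gap p1 /= in_itv/= => q0 /andP[t0 t1].
  nra.
apply: bigcup_connected => [|q _].
  by exists p => q _; exists 0; rewrite ?path0//= in_itv/= lexx ler01.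
apply: connected_continuous_connected; first exact: segment_connected.
exact: continuous_subspaceT.
Qed.

(** Were phi affine on the segment, the gap at t would be (1 - t) gap x.  The
    deviation of phi from its affine interpolation is at most
    2 t (1 - t) L |xi' - x'|, which the smallness assumption bounds by half of
    that value. *)
Lemma gap_segpt_ge (x xi : 'rV[R]_(m + 1)) (t : R) : 0 <= t <= 1 ->
  gap phi xi = 0 ->
  L * enorm (base xi - base x) <= gap phi x / 4 -> 0 <= gap phi x ->
  (1 - t) * (gap phi x / 2) <= gap phi (segpt x xi t).
Proof.
move=> /andP[t0 t1] xi0 xxi x0.
have hx : `|phi (base (segpt x xi t)) - phi (base x)| <=
    t * (L * enorm (base xi - base x)).
  rewrite (le_trans (phiL _ _))// base_segpt -{2}(segpt0 (base x) (base xi)).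
  by rewrite segptB subr0 enormZ ger0_norm// mulrCA.
have hxi : `|phi (base (segpt x xi t)) - phi (base xi)| <=
    (1 - t) * (L * enorm (base xi - base x)).
  rewrite (le_trans (phiL _ _))// base_segpt -{2}(segpt1 (base x) (base xi)).
  by rewrite segptB enormZ distrC ger0_norm ?subr_ge0// mulrCA.
have -> : gap phi (segpt x xi t) = (1 - t) * gap phi x + t * gap phi xi
   - ((1 - t) * (phi (base (segpt x xi t)) - phi (base x)) +
      t * (phi (base (segpt x xi t)) - phi (base xi))).
  by rewrite /gap height_segpt; ring.
move: hx hxi; rewrite xi0 !ler_norml => /andP[_ hx] /andP[_ hxi].
set A := phi _ - phi (base x) in hx *; set B := phi _ - phi (base xi) in hxi *.
set D := L * _ in xxi hx hxi.
have t1' : 0 <= 1 - t by rewrite subr_ge0.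
have h1 : (1 - t) * A <= (1 - t) * (t * D) by rewrite ler_wpM2l.
have h2 : t * B <= t * ((1 - t) * D) by rewrite ler_wpM2l.
have h3 : (1 - t) * t * D <= (1 - t) * t * (gap phi x / 4).
  by rewrite ler_wpM2l// mulr_ge0.
have h4 : (1 - t) * t * gap phi x <= (1 - t) * gap phi x.
  by rewrite ler_wpM2r// ler_piMr.
lra.
Qed.

(** * Boundary pieces seen from an interior point *)

Let alpha : R := 1 / (4 * (1 + L)).

Let alpha_gt0 : 0 < alpha. Proof. by rewrite divr_gt0// mulr_gt0. Qed.

Let alphaL : alpha * (1 + L) = 1 / 4.
Proof. by rewrite /alpha; field; rewrite gt_eqF. Qed.

Let lip_piece (x xi : 'rV[R]_(m + 1)) : 0 < gap phi x ->
  enorm (base xi - base x) <= alpha * gap phi x ->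
  L * enorm (base xi - base x) <= gap phi x / 4.
Proof.
move=> x0 xxi; rewrite (le_trans (ler_wpM2l hL xxi))//.
have : alpha * (1 + L) * gap phi x = gap phi x / 4 by rewrite alphaL; lra.
have := mulr_gt0 alpha_gt0 x0; lra.
Qed.

(** The vertical and horizontal parts of x - xi add up to at most
    r + L |xi' - x'| + |xi' - x'| <= r + alpha (1 + L) r. *)
Lemma enorm_graph_piece (x xi : 'rV[R]_(m + 1)) : 0 < gap phi x ->
  gap phi xi = 0 -> enorm (base xi - base x) <= alpha * gap phi x ->
  enorm (x - xi) <= 5 / 4 * gap phi x.
Proof.
move=> x0 xi0 xxi; have Lxxi := lip_piece x0 xxi.
rewrite (le_trans (enorm_le_base_height _))// baseB heightB.
rewrite -enormN opprB.
have -> : height x - height xi = gap phi x - (phi (base xi) - phi (base x)).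
  by move: xi0; rewrite /gap => /eqP; rewrite subr_eq0 => /eqP ->; ring.
have := ler_normB (gap phi x) (phi (base xi) - phi (base x)).
have := phiL (base xi) (base x); rewrite (gtr0_norm x0).
have : alpha * (1 + L) * gap phi x = gap phi x / 4 by rewrite alphaL; lra.
have := ler_wpM2l hL xxi; lra.
Qed.

Lemma graph_piece_strboundary (x : 'rV[R]_(m + 1)) : 0 < gap phi x ->
  graph_piece phi x (alpha * gap phi x) `<=` strboundary Omega x alpha.
Proof.
move=> x0 xi [bxi [xi' xiE]].
have -> : xi' = base xi by rewrite xiE base_mkpt.
move=> xxi; have /boundary_graph_domain xi0 := bxi.
have gapt t : 0 <= t <= 1 ->
    (1 - t) * (gap phi x / 2) <= gap phi (segpt x xi t).
  by move=> t01; apply: gap_segpt_ge => //; [exact: lip_piece|exact: ltW].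
split=> // [t /andP[t0 t1]|t /andP[t0 t1]].
  rewrite /Omega graph_domainE (lt_le_trans _ (gapt t _)) ?t0 ?(ltW t1)//.
  by rewrite mulr_gt0 ?subr_gt0// divr_gt0.
rewrite (le_trans _ (bdist_ge _))// ler_pdivlMr//.
rewrite (le_trans _ (gapt t _)) ?(ltW t0) ?(ltW t1)//.
have -> : alpha * Num.min t (1 - t) * enorm (x - xi) * (1 + L) =
    alpha * (1 + L) * (Num.min t (1 - t) * enorm (x - xi)) by ring.
have : Num.min t (1 - t) * enorm (x - xi) <= (1 - t) * (5 / 4 * gap phi x).
  apply: ler_pM; rewrite ?enorm_ge0 ?enorm_graph_piece//.
    by rewrite le_min (ltW t0) subr_ge0 ltW.
  by rewrite ge_min lexx orbT.
have : 0 < (1 - t) * gap phi x by rewrite mulr_gt0// subr_gt0.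
rewrite alphaL; lra.
Qed.

Lemma hcontent_graph_piece (x : 'rV[R]_(m + 1)) : 0 < gap phi x ->
  (((alpha / (3 * m.+1%:R)) ^+ m * gap phi x ^+ m)%:E
    <= hcontent m%:R (graph_piece phi x (alpha * gap phi x)))%E.
Proof.
move=> x0; pose s := alpha * gap phi x / m.+1%:R.
have s0 : 0 < s by rewrite divr_gt0// mulr_gt0.
have -> : (alpha / (3 * m.+1%:R)) ^+ m * gap phi x ^+ m = (s / 3) ^+ m.
  by rewrite -exprMn /s; congr (_ ^+ _); field.
(* the cube with corner base x and side s lies in the ball of radius alpha r,
   since its diameter is at most m s *)
apply: (@hcontent_ge_base_cube _ _ _ (base x)) => // v vQ.
exists (mkpt v (phi v)); last exact: base_mkpt.
split; first exact: boundary_mkpt.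
exists v => //; apply: (@le_trans _ _ (m%:R * s)).
  apply: enorm_le_coord => j; have /andP[? ?] := vQ j.
  have -> : (v - base x) 0 j = v 0 j - base x 0 j by rewrite !mxE.
  by rewrite ger0_norm ?subr_ge0// lerBlDl.
rewrite /s mulrCA ler_piMr ?(ltW (mulr_gt0 _ _))//.
by rewrite ler_pdivrMr// mul1r ler_nat.
Qed.

End lipschitz_graph.

Theorem proposition4p6 (R : realType) (m : nat) (L : R) (hL : 0 <= L) :
  let alpha : R := 1 / (4 * (1 + L)) in
  let eta : R := alpha in
  exists c c0 C0 : R, 0 < c /\
    forall phi : 'rV[R]_m -> R, elipschitz L phi ->
      (forall x : 'rV[R]_(m + 1), graph_domain phi x ->
         let r : R := height x - phi (base x) in
         let d : R := bdist (graph_domain phi) x in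
         let E : set 'rV[R]_(m + 1) := graph_piece phi x (eta * r) in
         [/\ r / (1 + L) <= d <= r,
             E `<=` strboundary (graph_domain phi) x alpha &
             ((c * d ^+ m)%:E <= hcontent m%:R E)%E]) /\
      content_condition (graph_domain phi) m%:R c0 C0 alpha.
Proof.
move=> alpha eta.
have L1 : 0 < 1 + L by rewrite ltr_wpDr.
have alpha0 : 0 < alpha by rewrite divr_gt0// mulr_gt0.
pose c : R := (alpha / (3 * m.+1%:R)) ^+ m.
have c0 : 0 < c by rewrite exprn_gt0// divr_gt0.
exists c, c, (2 * (1 + L)); split=> // phi phiL.
have dist x : graph_domain phi x ->
    [/\ 0 < gap phi x, gap phi x / (1 + L) <= bdist (graph_domain phi) x &
        0 < bdist (graph_domain phi) x <= gap phi x].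
  rewrite graph_domainE => x0; have dge := bdist_ge hL phiL x.
  have dle := bdist_le hL phiL x; rewrite gtr0_norm// in dle.
  by split=> //; rewrite dle andbT (lt_le_trans _ dge)// divr_gt0.
have content x : graph_domain phi x ->
    ((c * bdist (graph_domain phi) x ^+ m)%:E <=
     hcontent m%:R (graph_piece phi x (alpha * gap phi x)))%E.
  move=> /dist[x0 _ /andP[d0 dle]].
  apply: le_trans (hcontent_graph_piece hL phiL x0).
  by rewrite lee_fin ler_wpM2l ?(ltW c0)// lerXn2r// nnegrE ltW.
split=> [x Ox r d E|].
  have [x0 dge /andP[d0 dle]] := dist x Ox; split; last exact: content.
    by rewrite dge dle.
  exact: graph_piece_strboundary.
split.
- split; [exact: open_graph_domain hL phiL|exact: connected_graph_domain phiL|].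
  by exists (mkpt 0 (phi 0 + 1)); rewrite graph_domainE gap_mkpt.
- split=> //; first by lra.
    rewrite alpha0/= /alpha ler_pdivrMr ?mulr_gt0// mul1r; lra.
  by rewrite ler0n ler_nat leq_addr.
- move=> x Ox; have [x0 dge /andP[d0 _]] := dist x Ox.
  rewrite powR_mulrn ?(ltW d0)//; apply: le_trans (content x Ox) _.
  apply: le_hcontent => xi Exi; split.
    exact: (graph_piece_strboundary hL phiL).
  have [/(boundary_graph_domain hL phiL) xi0 [v xiE vx]] := Exi.
  have bxi : base xi = v by rewrite xiE base_mkpt.
  rewrite -bxi in vx; have := enorm_graph_piece hL phiL x0 xi0 vx.
  (* 5 / 4 * gap <= 5 / 4 * (1 + L) * d < 2 * (1 + L) * d *)
  rewrite /eball/= -enormN opprB => /le_lt_trans; apply.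
  rewrite ler_pdivrMr// in dge; lra.
Qed.
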